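(* Let $G=(V,E)$ be a finite graph, let $x$ be a number, and let $w:2^E\to\mathbb{Q}_{\ge 0}$ be a cooperative game with $w(\emptyset)=0$. Then the potential $P(w(G))$ of the connectivity augmented game $w(G)$ satisfies $$P(w(G))=\sum_{R\subseteq E,\ R\text{ flat}} w(R)\,C(G.R,x),$$ where $G.R$ is the graph obtained from $G$ by contracting the edges of $R$ and $C(H,x)$ denotes the chromatic polynomial of the graph $H$.
   Context: Graphs are finite; loops and multiple edges are allowed. ''Number'' may be read as complex number. The symbol $\subseteq$ allows equality. Components and flats: for $A\subseteq E$, $c(A)$ is the number of connected components of $(V,A)$. A set $A\subseteq E$ is flat if $c(A)>c(A\cup\{e\})$ for every $e\in E\setminus A$. Games: a cooperative game with finite player set $N$ is a function $v:2^N\to\mathbb{C}$ with $v(\emptyset)=0$; here the players are the edges of $G$. For $R\subseteq N$ put $c_R(v)=\sum_{T\subseteq R}(-1)^{|R|-|T|}v(T)$. For $\emptyset\ne R\subseteq N$ the basic game $d(R)$ is $d(R)(S)=1$ if $R\subseteq S$ and $0$ otherwise; one has $v=\sum_{\emptyset\neq R\subseteq N}c_R(v)\,d(R)$. Connectivity augmentation: for $\emptyset\neq R\subseteq E$, the basic connectivity augmented game is $b(R,G,x)(S)=|R|x^{c(R)}$ if $R\subseteq S\subseteq E$, and $0$ otherwise. The connectivity augmented game of $w$ is $w(G)=\sum_{\emptyset\neq R\subseteq E}c_R(w)\,b(R,G,x)$. Shapley value: for a player $e\in N$, $\phi_e(v)=\sum_{e\in R\subseteq N}\frac{1}{|R|}c_R(v)$.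 Potential: for a game $v$ on $N$ and $S\subseteq N$ let $v|_S$ be the restriction of $v$ to $2^S$. The potential $P$ is determined by $P(v|_\emptyset)=0$ and $P(v|_S)-P(v|_{S\setminus\{e\}})=\phi_e(v|_S)$ for all $S\subseteq N$ and $e\in S$; $P(v)=P(v|_N)$. Chromatic polynomial: for a graph $H=(V_H,E_H)$, $C(H,x)=\sum_{A\subseteq E_H}(-1)^{|A|}x^{c(A)}$, with $c(A)$ the number of connected components of $(V_H,A)$. Contraction: for $A\subseteq E$, $G.A$ is the graph whose vertices are the connected components of $(V,A)$ and which has exactly one edge for each $e\in E\setminus A$, joining the components containing the ends of $e$ (so loops and multiple edges may occur). *)

(* Defs.v *)
From HB Require Import structures.
From mathcomp Require Import all_boot all_order all_algebra.
From mathcomp Require Import reals complex.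
Set Implicit Arguments.
Unset Strict Implicit.
Unset Printing Implicit Defensive.
Import Order.TTheory GRing.Theory Num.Theory.
Local Open Scope ring_scope.

(* Loops are edges [e] with [(ends e).1 = (ends e).2]; parallel edges are edges
   with the same ends. The order of the two components of [ends e] is an
   artefact of the encoding: it is only used through the symmetric [adj]. *)
Record multigraph := Multigraph {
  vertex : finType;
  edge : finType;
  ends : edge -> vertex * vertex }.

Section Components.
Variable G : multigraph.
Implicit Types (A : {set edge G}) (u v : vertex G).

Definition adj A : rel (vertex G) :=
  fun u v => [exists e in A, (ends e == (u, v)) || (ends e == (v, u))].

Definition component A u : {set vertex G} := [set v | connect (adj A) u v].

Definition components A : {set {set vertex G}} :=
  [set component A u | u : vertex G].

Definition ncomp A : nat := #|components A|.

Definition flat A : bool := [forall e in ~: A, (ncomp (e |: A) < ncomp A)%N].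

Lemma component_mem A u : component A u \in components A.
Proof. exact: imset_f. Qed.

Definition contraction_vertex A u : {B : {set vertex G} | B \in components A} :=
  exist _ (component A u) (component_mem A u).

Definition contraction A : multigraph :=
  @Multigraph {B : {set vertex G} | B \in components A}
    {e : edge G | e \notin A}
    (fun e => (contraction_vertex A (ends (val e)).1,
               contraction_vertex A (ends (val e)).2)).

End Components.

Definition chromatic (F : fieldType) (H : multigraph) (x : F) : F :=
  \sum_(A : {set edge H}) (-1) ^+ #|A| * x ^+ ncomp A.

(* A game is a function [v : {set N} -> F] with [v set0 = 0]. For [S : {set N}],
   the restriction of [v] to the player set [S] is represented by the pair
   [S], [v], where only the values of [v] on subsets of [S] matter. *)
Section Games.
Variables (F : fieldType) (N : finType).
Implicit Types (v : {set N} -> F) (R S T : {set N}).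

Definition dividend v R : F :=
  \sum_(T : {set N} | T \subset R) (-1) ^+ (#|R| - #|T|) * v T.

Definition shapley S v (e : N) : F :=
  \sum_(R : {set N} | (e \in R) && (R \subset S)) #|R|%:R^-1 * dividend v R.

(* [P S] stands for the potential of the restriction of [v] to [S]. *)
Definition is_potential v (P : {ffun {set N} -> F}) : bool :=
  (P set0 == 0) &&
  [forall S : {set N}, forall e in S, P S - P (S :\ e) == shapley S v e].

Lemma is_potentialP v (P : {ffun {set N} -> F}) :
  reflect (P set0 = 0 /\
           forall S e, e \in S -> P S - P (S :\ e) = shapley S v e)
          (is_potential v P).
Proof.
apply: (iffP andP) => [[/eqP P0 /forallP PS] | [P0 PS]]; split=> //.
- by move=> S e eS; apply/eqP; have /forall_inP := PS S; apply.
- exact/eqP.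
- by apply/forallP => S; apply/forall_inP => e eS; apply/eqP/PS.
Qed.

Lemma potential_exists v : exists P, is_potential v P.
Proof.
exists [ffun S : {set N} => \sum_(R : {set N} | (R != set0) && (R \subset S))
  #|R|%:R^-1 * dividend v R].
apply/is_potentialP; split=> [|S e eS].
  by rewrite ffunE big_pred0 // => R; rewrite subset0 andNb.
rewrite !ffunE (bigID (fun R : {set N} => e \in R)) /=.
rewrite [X in _ + X - _](eq_bigl
  (fun R : {set N} => (R != set0) && (R \subset S :\ e))); last first.
  by move=> R; rewrite subsetD1 andbA.
rewrite addrK; apply: eq_bigl => R.
case eR: (e \in R); rewrite ?andbF ?andbT //=.
by have -> : R != set0 by apply/set0Pn; exists e.
Qed.

Lemma potential_unique v (P Q : {ffun {set N} -> F}) :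
  is_potential v P -> is_potential v Q -> P = Q.
Proof.
move=> /is_potentialP[P0 PS] /is_potentialP[Q0 QS]; apply/ffunP => S.
elim: {S}#|S| {-2}S (erefl #|S|) => [|n IHn] S cS.
  by rewrite (cards0_eq cS) P0 Q0.
have /card_gt0P[e eS] : (0 < #|S|)%N by rewrite cS.
have /IHn eqPQ : #|S :\ e| = n by apply: succn_inj; rewrite -cS (cardsD1 e S) eS.
by apply: (addIr (- P (S :\ e))); rewrite PS // eqPQ QS.
Qed.

Definition potential_fun v : {ffun {set N} -> F} := xchoose (potential_exists v).

Lemma potential_funP v : is_potential v (potential_fun v).
Proof. exact: xchooseP. Qed.

Definition potential v : F := potential_fun v [set: N].

End Games.

Section Augmentation.
Variables (F : fieldType) (G : multigraph) (x : F).
Implicit Types (w : {set edge G} -> F) (R S : {set edge G}).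

Definition basic_augmented R S : F :=
  if R \subset S then #|R|%:R * x ^+ ncomp R else 0.

Definition augmented w S : F :=
  \sum_(R : {set edge G} | R != set0) dividend w R * basic_augmented R S.

End Augmentation.

(* Main.v *)
Require Import Defs.
From HB Require Import structures.
From mathcomp Require Import all_boot all_order all_algebra.
From mathcomp Require Import reals complex.
Set Implicit Arguments.
Unset Strict Implicit.
Unset Printing Implicit Defensive.
Import Order.TTheory GRing.Theory Num.Theory.
Local Open Scope ring_scope.

(** The dividends of [w(G)] are [|R| x^c(R) c_R(w)], so its potential is
    [\sum_R x^c(R) c_R(w)]. Expanding [c_R(w)] and exchanging the two sums, the
    coefficient of [w(T)] is the sum of [(-1)^|R \ T| x^c(R)] over [T \subset R],
    which is the chromatic polynomial of [G.T]. If [T] is not flat, some edge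
    [e] outside [T] is a loop of [G.T], and [R |-> R + e] cancels this sum. *)

(** * Signed sums over the subsets of a finite set *)

Lemma sum_set_split (V : zmodType) (I : finType) (e : I) (f : {set I} -> V) :
  \sum_(S : {set I}) f S = \sum_(S : {set I} | e \notin S) (f S + f (e |: S)).
Proof.
rewrite big_split /= (bigID (fun S : {set I} => e \notin S)) /=; congr (_ + _).
rewrite (reindex_onto (fun S : {set I} => e |: S) (fun S => S :\ e)) /=; last first.
  by move=> S; rewrite negbK => /setD1K.
apply: eq_bigl => S; rewrite setU11 /=.
apply/eqP/idP => [<-|/setU1K //]; first by rewrite setD11.
Qed.

(** Toggling [e] is a sign-reversing involution on sets. Both vanishing results below, for
    alternating sums over intervals and for non-flat sets, rest on it. *)
Lemma sum_set_cancel (V : zmodType) (I : finType) (e : I) (f : {set I} -> V) :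
  (forall S : {set I}, e \notin S -> f (e |: S) = - f S) -> \sum_(S : {set I}) f S = 0.
Proof.
by move=> fN; rewrite (sum_set_split e) big1 // => S /fN ->; rewrite subrr.
Qed.

(** Möbius orthogonality in the Boolean lattice: if [Q] is a proper subset of [R], toggle an element
    of [R] outside [Q]. *)
Lemma sum_interval_sign (F : fieldType) (I : finType) (Q R : {set I}) :
  \sum_(T : {set I} | (Q \subset T) && (T \subset R)) (-1) ^+ (#|R| - #|T|)
  = (Q == R)%:R :> F.
Proof.
have [->|QR] := eqVneq Q R.
  rewrite (big_pred1 R) ?subnn // => T.
  by rewrite -eqEsubset eq_sym.
have [sQR|nQR] := boolP (Q \subset R); last first.
  rewrite big_pred0 // => T; apply: contraNF nQR => /andP[]; exact: subset_trans.
have /properP[_ [e eR eQ]] : Q \proper R by rewrite properEneq QR.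
rewrite big_mkcond /=; apply: (@sum_set_cancel _ _ e) => S eS.
have -> : (Q \subset e |: S) = (Q \subset S).
  by rewrite -subDset (setDidPl _) // disjoint_sym disjoints1.
rewrite subUset sub1set eR /=; case: ifP => [/andP[_ SR]|]; last by rewrite oppr0.
(* The strict inequality makes the truncated difference of cardinals drop by exactly one when [e]
   joins [S], so the sign flips. *)
have ltSR : (#|S| < #|R|)%N.
  by apply: proper_card; apply/properP; split=> //; exists e.
by rewrite cardsU1 eS add1n -[(#|R| - #|S|)%N]prednK ?subn_gt0 // -subnS
           exprS mulN1r opprK.
Qed.

(** * The potential in terms of dividends *)

Section Potential.
Variable F : numFieldType.

(** When [e] joins [S :\ e], the new terms of the sum are those with [e \in R], which add up to the
    Shapley value of [e]; uniqueness of the potential concludes. *)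
Lemma potentialE (N : finType) (v : {set N} -> F) :
  potential v = \sum_(R : {set N} | R != set0) #|R|%:R^-1 * dividend v R.
Proof.
pose P := [ffun S : {set N} => \sum_(R : {set N} | (R != set0) && (R \subset S))
  #|R|%:R^-1 * dividend v R].
suff PP : is_potential v P.
  rewrite /potential (potential_unique (potential_funP v) PP) ffunE.
  by apply: eq_bigl => R; rewrite subsetT andbT.
apply/is_potentialP; split=> [|S e eS].
  by rewrite ffunE big_pred0 // => R; rewrite subset0 andNb.
rewrite !ffunE (bigID (fun R : {set N} => e \in R)) /=.
rewrite [X in _ + X - _](eq_bigl
  (fun R : {set N} => (R != set0) && (R \subset S :\ e))); last first.
  by move=> R; rewrite subsetD1 andbA.
rewrite addrK; apply: eq_bigl => R.
case eR: (e \in R); rewrite ?andbF ?andbT //=.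
by have -> : R != set0 by apply/set0Pn; exists e.
Qed.

Variables (G : multigraph) (x : F).
Implicit Types (w : {set edge G} -> F) (R T : {set edge G}).

Lemma dividend_augmented w R : R != set0 ->
  dividend (augmented x w) R = #|R|%:R * x ^+ ncomp R * dividend w R.
Proof.
move=> R0; rewrite /dividend -/(dividend w R).
under eq_bigr do rewrite mulr_sumr.
rewrite exchange_big /= (bigD1 R) //= [X in _ + X]big1 ?addr0 => [|Q /andP[_ QR]].
(* In the term [Q = R], only [T = R] lies between [R] and [R]. *)
- rewrite (bigD1 R) //= big1 ?addr0 => [|T /andP[TR nTR]].
    by rewrite /basic_augmented subxx subnn mul1r mulrC.
  rewrite /basic_augmented; case: ifP; rewrite ?mulr0 // => RT.
  by rewrite eqEsubset TR RT in nTR.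
(* For [Q] other than [R], the augmented value is constant on the supersets of [Q], so it factors
   out of a vanishing alternating sum. *)
have := sum_interval_sign F Q R; rewrite (negPf QR).
rewrite big_mkcondl /= => s0.
transitivity (\sum_(T : {set edge G} | T \subset R)
  (if Q \subset T then (-1) ^+ (#|R| - #|T|) else 0) *
    (dividend w Q * (#|Q|%:R * x ^+ ncomp Q))).
  apply: eq_bigr => T _; rewrite /basic_augmented.
  by case: ifP => _; rewrite ?mulr0 ?mul0r.
by rewrite -mulr_suml s0 mul0r.
Qed.

Lemma potential_augmented w : w set0 = 0 ->
  potential (augmented x w) =
  \sum_T w T *
    \sum_(R : {set edge G} | T \subset R) (-1) ^+ (#|R| - #|T|) * x ^+ ncomp R.
Proof.
move=> w0; rewrite potentialE.
have dw0 : dividend w set0 = 0.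
  by rewrite /dividend big1 // => T; rewrite subset0 => /eqP ->; rewrite w0 mulr0.
(* The weight [#|R|] cancels its inverse, as the characteristic is zero; the empty set can be added
   because its dividend vanishes. *)
transitivity (\sum_R x ^+ ncomp R * dividend w R).
  rewrite [RHS](bigD1 set0) //= dw0 mulr0 add0r; apply: eq_bigr => R R0.
  by rewrite dividend_augmented // !mulrA mulVf ?mul1r // pnatr_eq0 cards_eq0.
under eq_bigr do rewrite mulr_sumr.
rewrite (exchange_big_dep xpredT) //=; apply: eq_bigr => T _.
by rewrite mulr_sumr; apply: eq_bigr => R _; rewrite mulrC mulrAC mulrC.
Qed.

End Potential.

(** * Components of an edge set and the effect of adding an edge *)

Section Connectivity.
Variable G : multigraph.
Implicit Types (A T R : {set edge G}) (u v : vertex G) (e : edge G).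

Lemma adj_sym A : symmetric (adj A).
Proof. by move=> u v; apply: eq_existsb => e; rewrite orbC. Qed.

Lemma connect_adj_sym A : connect_sym (adj A).
Proof. exact: sym_connect_sym (adj_sym A). Qed.

Lemma adj_ends A e : e \in A -> adj A (ends e).1 (ends e).2.
Proof. by move=> eA; apply/exists_inP; exists e; rewrite // -surjective_pairing eqxx. Qed.

(** Minimality of connectivity among equivalence relations, by induction along a path. It reduces
    later comparisons of connectivity to single edges. *)
Lemma connect_adj_min A (r : rel (vertex G)) :
  reflexive r -> symmetric r -> transitive r ->
  (forall e, e \in A -> r (ends e).1 (ends e).2) ->
  subrel (connect (adj A)) r.
Proof.
move=> rr rs rt rA u v /connectP[p]; elim: p u => [u _ -> //|z p IHp] u /=.
case/andP=> /exists_inP[e /rA re eE] /IHp{IHp} IHp /IHp; apply: rt.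
by case/orP: eE => /eqP eE; rewrite eE // rs in re.
Qed.

Lemma connect_adjS A R u v :
  A \subset R -> connect (adj A) u v -> connect (adj R) u v.
Proof.
move=> /subsetP sAR; apply: connect_adj_min.
- exact: connect0.
- exact: connect_adj_sym.
- exact: connect_trans.
by move=> e /sAR eR; apply/connect1/adj_ends.
Qed.

Lemma eq_component A u v : (component A u == component A v) = connect (adj A) u v.
Proof.
apply/eqP/idP => [eqC|uv]; last first.
  by apply/setP => z; rewrite !inE (same_connect (connect_adj_sym A) uv).
have : v \in component A v by rewrite inE.
by rewrite -eqC inE.
Qed.

Lemma ncomp_redundant_edge A e :
  connect (adj A) (ends e).1 (ends e).2 -> ncomp (e |: A) = ncomp A.
Proof.
move=> ce; rewrite /ncomp /components.
suff eqC : component (e |: A) =1 component A by rewrite (eq_imset _ eqC).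
move=> u; apply/setP => v; rewrite !inE.
apply/idP/idP; last by apply: connect_adjS; exact: subsetUr.
apply: connect_adj_min.
- exact: connect0.
- exact: connect_adj_sym.
- exact: connect_trans.
by move=> f /setU1P[->|fA] //; apply/connect1/adj_ends.
Qed.

Lemma ncomp_bridge A e :
  ~~ connect (adj A) (ends e).1 (ends e).2 -> (ncomp (e |: A) < ncomp A)%N.
Proof.
(* [g] sends a component of [A] to the component of [e |: A] containing it; the union avoids
   choosing a representative. It is onto, and it merges the components of the two ends of [e], so it
   is not injective. *)
move=> nce; pose g (C : {set vertex G}) := \bigcup_(v in C) component (e |: A) v.
have gE u : g (component A u) = component (e |: A) u.
  apply/setP => z; apply/bigcupP/idP => [[v]|uz]; last by exists u => //; rewrite inE.
  rewrite !inE => /(connect_adjS (subsetUr [set e] A)).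
  exact: connect_trans.
have -> : ncomp (e |: A) = #|g @: components A|.
  by rewrite /ncomp /components -imset_comp (eq_imset _ (fun u => esym (gE u))).
rewrite ltn_neqAle leq_imset_card andbT; apply: contra nce => /imset_injP ginj.
rewrite -eq_component; apply/eqP/ginj; try exact: component_mem.
rewrite !gE; apply/eqP; rewrite eq_component; apply/connect1/adj_ends.
exact: setU11.
Qed.

Lemma nonflat_loop A : ~~ flat A ->
  exists2 e, e \notin A & connect (adj A) (ends e).1 (ends e).2.
Proof.
rewrite negb_forall_in => /exists_inP[e]; rewrite inE => eA lt.
by exists e => //; apply: contraR lt; exact: ncomp_bridge.
Qed.

End Connectivity.

(** Taking preimages under [h] matches the components of [B] with those of [A]; surjectivity of [h]
    makes this injective. *)
Lemma ncomp_surj (G H : multigraph) (h : vertex G -> vertex H)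
    (A : {set edge G}) (B : {set edge H}) :
  (forall a, exists u, h u = a) ->
  (forall u v, connect (adj B) (h u) (h v) = connect (adj A) u v) ->
  ncomp B = ncomp A.
Proof.
move=> hsurj hconn; rewrite /ncomp.
have -> : components A = (fun C : {set vertex H} => h @^-1: C) @: components B.
  apply/setP => C; apply/imsetP/imsetP => [[u _ ->]|[_ /imsetP[a _ ->] ->]].
    exists (component B (h u)); first exact: component_mem.
    by apply/setP => v; rewrite !inE hconn.
  have [u <-] := hsurj a; exists u => //.
  by apply/setP => v; rewrite !inE hconn.
rewrite [RHS]card_imset // => C D eqCD; apply/setP => a; have [u <-] := hsurj a.
by move/setP/(_ u): eqCD; rewrite !inE.
Qed.

(** * Contraction and its chromatic polynomial *)

Section Contraction.
Variables (G : multigraph) (T : {set edge G}).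
Implicit Types (B : {set edge (contraction T)}) (u v : vertex G).

Let h u : vertex (contraction T) := contraction_vertex T u.

Lemma contraction_vertex_eq u v : (h u == h v) = connect (adj T) u v.
Proof. by rewrite -val_eqE /= eq_component. Qed.

Lemma contraction_vertex_surj a : exists u, h u = a.
Proof.
by case: a => C CT; have /imsetP[u _ eC] := CT; exists u; apply/val_inj.
Qed.

Lemma connect_contraction B u v :
  connect (adj B) (h u) (h v) = connect (adj (T :|: val @: B)) u v.
Proof.
set A := T :|: _; have Asym := connect_adj_sym A.
(* [rep] picks a vertex in each component of [T], which carries connectivity in [A] over to the
   contraction. The choice is immaterial, since [T] is contained in [A]. *)
have [rep hrep] := fin_all_exists contraction_vertex_surj.
have sTA w z : connect (adj T) w z -> connect (adj A) w z.
  by apply: connect_adjS; exact: subsetUl.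
have repP w : connect (adj A) (rep (h w)) w.
  by apply: sTA; rewrite -contraction_vertex_eq; apply/eqP/hrep.
have repE w z :
    connect (adj A) (rep (h w)) (rep (h z)) = connect (adj A) w z.
  by rewrite (same_connect Asym (repP w)) (same_connect_r Asym (repP z)).
have edgeA (e : edge (contraction T)) : e \in B -> val e \in A.
  by move=> eB; apply/setUP; right; apply: imset_f.
apply/idP/idP => [|].
  rewrite -repE; apply: (connect_adj_min
    (r := fun a b => connect (adj A) (rep a) (rep b))).
  - by move=> a; exact: connect0.
  - by move=> a b; exact: Asym.
  - by move=> b a c; exact: connect_trans.
  by move=> e /edgeA eA; rewrite repE; apply/connect1/adj_ends.
apply: (connect_adj_min (r := fun u v => connect (adj B) (h u) (h v))).
- by move=> w; exact: connect0.
- by move=> w z; exact: connect_adj_sym.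
- by move=> z w t; exact: connect_trans.
move=> e /setUP[eT|/imsetP[f fB ->]]; last exact/connect1/(adj_ends fB).
suff /eqP -> : h (ends e).1 == h (ends e).2 by exact: connect0.
by rewrite contraction_vertex_eq; apply/connect1/adj_ends.
Qed.

Lemma ncomp_contraction B : ncomp B = ncomp (T :|: val @: B).
Proof.
exact: ncomp_surj contraction_vertex_surj (@connect_contraction B).
Qed.

Lemma chromatic_contraction (F : fieldType) (x : F) :
  chromatic (contraction T) x =
  \sum_(R : {set edge G} | T \subset R) (-1) ^+ (#|R| - #|T|) * x ^+ ncomp R.
Proof.
(* Edge sets [B] of the contraction correspond to the supersets [T :|: val @: B] of [T]. Edges of
   the contraction lie outside [T], so this union is disjoint and the sign exponent is [#|B|]. *)
rewrite (reindex_onto (fun B : {set edge (contraction T)} => T :|: val @: B)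
  (fun R => val @^-1: R)) /=; last first.
  move=> R /subsetP sTR; apply/setP => e; rewrite inE.
  have [/sTR -> //|eT] := boolP (e \in T).
  apply/imsetP/idP => [[f]|eR]; first by rewrite inE => fR ->.
  by exists (exist _ e eT); rewrite ?inE.
apply: eq_big => [B|B _].
  rewrite subsetUl; symmetry; apply/eqP/setP => e.
  by rewrite !inE (negPf (valP e)) mem_imset //; exact: val_inj.
rewrite ncomp_contraction cardsU (_ : T :&: _ = set0) ?cards0 ?subn0.
  by rewrite addKn card_imset //; exact: val_inj.
apply/setP => e; rewrite !inE; apply/andP => -[eT /imsetP[f _ ef]].
by have := valP f; rewrite /= -ef eT.
Qed.

Lemma chromatic_contraction_nonflat (F : fieldType) (x : F) :
  ~~ flat T -> chromatic (contraction T) x = 0.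
Proof.
case/nonflat_loop=> e eT ce; rewrite chromatic_contraction big_mkcond /=.
apply: (@sum_set_cancel _ _ e) => R eR.
have -> : (T \subset e |: R) = (T \subset R).
  by rewrite -subDset (setDidPl _) // disjoint_sym disjoints1.
case: ifP => [TR|]; last by rewrite oppr0.
(* The ends of [e] are connected in [T], hence in [R]: adding [e] keeps the component count and
   changes only the sign. *)
rewrite (ncomp_redundant_edge (connect_adjS TR ce)) cardsU1 eR add1n.
by rewrite subSn ?subset_leq_card // exprS mulN1r mulNr.
Qed.

End Contraction.

Theorem theorem2 (R : realType) (G : multigraph) (x : R[i])
    (w : {set edge G} -> rat)
    (w_ge0 : forall A : {set edge G}, 0 <= w A) (w_set0 : w set0 = 0) :
  potential (augmented x (fun A : {set edge G} => ratr (w A) : R[i])) =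
  \sum_(A : {set edge G} | flat A) ratr (w A) * chromatic (contraction A) x.
Proof.
rewrite potential_augmented ?w_set0 ?rmorph0 //.
(* Extend the right-hand sum by zero to all edge sets and compare the coefficients of each [w A]. *)
rewrite [RHS]big_mkcond /=; apply: eq_bigr => A _.
rewrite -chromatic_contraction; case: ifPn => // nfA.
by rewrite chromatic_contraction_nonflat // mulr0.
Qed.
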